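(* Let $0<\delta\le 1$. For every $0 < p \le 10^{-3}\delta^5$ and every large enough $n$ there is an $n$-vertex tripartite graph such that every pair of its vertex classes spans a bipartite graph of density at least $p$ which is $\langle\delta\rangle$-regular, and yet the graph is triangle free.
   Context: For a bipartite graph $G$ and vertex subsets $A',B'$ on the two sides, $d_G(A',B')=e_G(A',B')/(|A'||B'|)$ where $e_G(A',B')$ is the number of edges between $A'$ and $B'$; the density of a bipartite graph on $(A,B)$ is $d_G(A,B)$. A bipartite graph $G$ on $(A,B)$ is $\langle\delta\rangle$-regular if for all subsets $A'\subseteq A$ and $B'\subseteq B$ with $|A'|\ge\delta|A|$ and $|B'|\ge\delta|B|$ we have $d_G(A',B')\ge\frac12 d_G(A,B)$. *)

(* Defs.v *)
From HB Require Import structures.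
From mathcomp Require Import all_boot all_order all_algebra.
From mathcomp Require Import reals.
Set Implicit Arguments.
Unset Strict Implicit.
Unset Printing Implicit Defensive.
Import Order.TTheory GRing.Theory Num.Theory.
Local Open Scope ring_scope.

Definition simple_graph (V : finType) (e : rel V) : Prop :=
  symmetric e /\ irreflexive e.

Definition independent (V : finType) (e : rel V) (A : {set V}) : Prop :=
  {in A &, forall x y, ~~ e x y}.

Definition tripartition (V : finType) (e : rel V) (A B C : {set V}) : Prop :=
  [/\ A :|: B :|: C = [set: V],
      [/\ [disjoint A & B], [disjoint B & C] & [disjoint A & C]]
    & [/\ independent e A, independent e B & independent e C]].

(* Ordered pairs are counted, so each edge is counted once only when A and B
   are disjoint, which is the only case in which this is used. *)
Definition num_edges (V : finType) (e : rel V) (A B : {set V}) : nat :=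
  #|[set xy in setX A B | e xy.1 xy.2]|.

(* If A or B is empty the value is 0, as 0^-1 = 0. *)
Definition density (R : realType) (V : finType) (e : rel V)
    (A B : {set V}) : R :=
  (num_edges e A B)%:R / (#|A|%:R * #|B|%:R).

Definition half_regular (R : realType) (delta : R) (V : finType) (e : rel V)
    (A B : {set V}) : Prop :=
  forall A' B' : {set V}, A' \subset A -> B' \subset B ->
    delta * #|A|%:R <= #|A'|%:R -> delta * #|B|%:R <= #|B'|%:R ->
    1 / 2 * density R e A B <= density R e A' B'.

Definition triangle_free (V : finType) (e : rel V) : Prop :=
  forall x y z : V, ~ [/\ e x y, e y z & e x z].

(* Main.v *)
Require Import Defs.
From HB Require Import structures.
From mathcomp Require Import all_boot all_order all_algebra all_field.
From mathcomp Require Import reals.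
From mathcomp Require Import ring lra.
Set Implicit Arguments.
Unset Strict Implicit.
Unset Printing Implicit Defensive.
Import Order.TTheory GRing.Theory Num.Theory.
Local Open Scope ring_scope.

(* The vertices are a balanced blow-up of three copies of F^2, where F is a
   field with q = 3^k elements and 24 / delta^2 <= q <= 72 / delta^2.  Join x to
   y by y2 - x2 = 2 (y1 - x1)^2 from the first copy to the second and from the
   second to the third, and by y2 - x2 = (y1 - x1)^2 + eps from the first to the
   third, with eps not a square.  Since 2 s^2 + 2 t^2 - (s + t)^2 = (s - t)^2, a
   triangle would make eps a square.  Each of the three graphs is q-regular on
   q^2 + q^2 vertices and two vertices have at most one common neighbour, so the
   number of neighbours in a weighted set has small variance; hence sets that
   are large compared with q^(3/2) span about the expected number of edges. *)

(** * Edge counts from degrees and codegrees *)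

Definition neighbours (U : finType) (E : rel U) (u : U) : {set U} :=
  [set v | E u v].

Lemma sum_degree (R : realFieldType) (U : finType) (E : rel U) (q : nat)
    (w : U -> R) :
  (forall u, #|neighbours E u| = q) ->
  \sum_v \sum_u w u * (E u v)%:R = q%:R * \sum_u w u.
Proof.
move=> deg; rewrite exchange_big mulr_sumr; apply: eq_bigr => u _ /=.
rewrite -mulr_sumr -natr_sum mulrC; congr (_%:R * _).
by rewrite -big_mkcond sum1_card -(deg u) cardsE.
Qed.

(** [E] is read as a bipartite graph between two copies of [U]. Expanding [\sum_v D v ^+ 2] weights
    each pair [u], [u'] by its codegree: [q] on the diagonal, at most 1 off it. As [D] sums to
    [q * W] over [q * q] vertices, centring at [W / q] subtracts exactly [W ^+ 2]. *)
Lemma degree_variance (R : realFieldType) (U : finType) (E : rel U) (q : nat)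
    (w : U -> R) :
  (0 < q)%N -> #|U| = (q * q)%N ->
  (forall u, #|neighbours E u| = q) ->
  (forall u u', u != u' -> (#|neighbours E u :&: neighbours E u'| <= 1)%N) ->
  (forall u, 0 <= w u) ->
  \sum_v (\sum_u w u * (E u v)%:R - (\sum_u w u) / q%:R) ^+ 2
    <= q%:R * \sum_u w u ^+ 2.
Proof.
move=> q_gt0 cardU deg codeg w_ge0.
have qn0 : q%:R != 0 :> R by rewrite pnatr_eq0 -lt0n.
set W := \sum_u w u; pose D v := \sum_u w u * (E u v)%:R.
have sumD2 : \sum_v D v ^+ 2 <= W ^+ 2 + q%:R * \sum_u w u ^+ 2.
  have -> : \sum_v D v ^+ 2 =
      \sum_u \sum_u' w u * w u' * #|neighbours E u :&: neighbours E u'|%:R.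
    under eq_bigr => v _ do rewrite expr2 big_distrlr /=.
    rewrite exchange_big; apply: eq_bigr => u _ /=.
    rewrite exchange_big; apply: eq_bigr => u' _ /=.
    rewrite -sum1_card natr_sum mulr_sumr [RHS]big_mkcond; apply: eq_bigr => v _ /=.
    rewrite !inE; case: (E u v); case: (E u' v); rewrite /= ?mulr1 ?mulr0 ?mul0r //.
  rewrite expr2 big_distrlr /= mulr_sumr -big_split /=; apply: ler_sum => u _.
  rewrite [leRHS]addrC (bigD1 u) //= [in leRHS](bigD1 u) //= setIid deg addrA.
  apply: lerD; first by rewrite expr2 mulrC lerDl mulr_ge0.
  apply: ler_sum => u' u'u; rewrite ler_piMr ?mulr_ge0 // lern1.
  by rewrite codeg // eq_sym.
have -> : \sum_v (D v - W / q%:R) ^+ 2 = \sum_v D v ^+ 2 - W ^+ 2.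
  under eq_bigr => v _ do rewrite sqrrB.
  rewrite big_split sumrB /= sumr_const cardU.
  under [X in _ - X + _]eq_bigr => v _ do rewrite -mulrnAr.
  rewrite -mulr_suml (sum_degree _ deg) -/W -(mulr_natr _ (q * q)) natrM.
  by field.
by rewrite lerBlDl.
Qed.

(** The weights will be the fibre sizes of subsets of two blown-up classes. The main term is
    [W * W' / q]. The variance bound costs an eighth of it plus [2 q^2 M^2], and the largeness
    assumption bounds the latter by another eighth. *)
Lemma weighted_edges_lb (R : realFieldType) (U : finType) (E : rel U) (q : nat)
    (w w' : U -> R) (M : R) :
  (0 < q)%N -> #|U| = (q * q)%N ->
  (forall u, #|neighbours E u| = q) ->
  (forall u u', u != u' -> (#|neighbours E u :&: neighbours E u'| <= 1)%N) ->
  (forall u, 0 <= w u <= M) -> (forall u, 0 <= w' u <= M) ->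
  0 < M ->
  16 * q%:R ^+ 3 * M ^+ 2 <= (\sum_u w u) * (\sum_u w' u) ->
  3 / 4 / q%:R * ((\sum_u w u) * (\sum_u w' u))
    <= \sum_u \sum_v w u * w' v * (E u v)%:R.
Proof.
move=> q_gt0 cardU deg codeg w_bd w'_bd M_gt0 large.
have w_ge0 u : 0 <= w u by case/andP: (w_bd u).
have w'_ge0 u : 0 <= w' u by case/andP: (w'_bd u).
have q0 : 0 < q%:R :> R by rewrite ltr0n.
set W := \sum_u w u in large *; set W' := \sum_u w' u in large *.
have W_gt0 : 0 < W.
  rewrite lt_neqAle sumr_ge0 // andbT; apply/eqP => W0.
  move: large; rewrite -W0 mul0r leNgt => /negP[].
  by rewrite !mulr_gt0 ?exprn_gt0 ?ltr0n.
pose D v := \sum_u w u * (E u v)%:R - W / q%:R.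
have -> : \sum_u \sum_v w u * w' v * (E u v)%:R =
    W * W' / q%:R + \sum_v w' v * D v.
  rewrite exchange_big /=.
  rewrite [W * _]mulrC -mulrA [X in X + _]mulr_suml -big_split /=.
  apply: eq_bigr => v _.
  rewrite /D mulrBr addrC subrK mulr_sumr.
  by apply: eq_bigr => u _; rewrite mulrCA mulrA.
have var : \sum_v D v ^+ 2 <= q%:R * (M * W).
  apply: le_trans (degree_variance q_gt0 cardU deg codeg w_ge0) _.
  rewrite ler_pM2l // mulr_sumr; apply: ler_sum => u _.
  by rewrite expr2 ler_wpM2r //; case/andP: (w_bd u).
(* AM-GM with the threshold [th = W / (8 q)], chosen to halve the allowed error *)
pose th := W / (8 * q%:R).
have th0 : 0 < th by rewrite divr_gt0 ?mulr_gt0 ?ltr0n.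
(* [w' v] is kept in the first term, so that it sums to [W'], and replaced by [M] in the quadratic
   term, so that the variance bound applies. *)
have lb v : - (th * w' v + M / (4 * th) * D v ^+ 2) <= w' v * D v.
  have h : - (th + D v ^+ 2 / (4 * th)) <= D v.
    rewrite -subr_ge0 opprK.
    have -> : D v + (th + D v ^+ 2 / (4 * th)) = (D v + 2 * th) ^+ 2 / (4 * th).
      by field; rewrite gt_eqF.
    by apply: divr_ge0; [apply: sqr_ge0|rewrite mulr_ge0 ?ler0n ?ltW].
  apply: le_trans (ler_wpM2l (w'_ge0 v) h).
  rewrite mulrN lerN2 mulrDr mulrC lerD2l mulrA [M / _ * _]mulrAC.
  apply: ler_wpM2r; first by rewrite invr_ge0 mulr_ge0 ?ler0n ?ltW.
  by apply: ler_wpM2r; [exact: sqr_ge0|case/andP: (w'_bd v)].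
have : - (th * W' + M / (4 * th) * (q%:R * (M * W))) <= \sum_v w' v * D v.
  apply: le_trans (ler_sum _ (fun v _ => lb v)).
  rewrite sumrN lerN2 big_split /= -!mulr_sumr lerD2l ler_wpM2l //.
  by apply: divr_ge0; [exact: ltW|rewrite mulr_ge0 ?ler0n ?ltW].
have -> : th * W' + M / (4 * th) * (q%:R * (M * W)) =
    W * W' / q%:R / 8 + (16 * q%:R ^+ 3 * M ^+ 2) / q%:R / 8.
  by rewrite /th; field; rewrite !gt_eqF.
have : (16 * q%:R ^+ 3 * M ^+ 2) / q%:R <= W * W' / q%:R.
  by rewrite ler_pM2r ?invr_gt0.
have -> : 3 / 4 / q%:R * (W * W') = W * W' / q%:R * (3 / 4) by ring.
lra.
Qed.

(** * Blow-ups: fibres, balanced maps and regularity *)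

Lemma num_edges_fibres (V U : finType) (e : rel V) (E : rel U) (g : V -> U)
    (A B : {set V}) :
  {in A & B, forall x y, e x y = E (g x) (g y)} ->
  num_edges e A B =
  (\sum_u \sum_v #|[set x in A | g x == u]| * #|[set y in B | g y == v]| * E u v)%N.
Proof.
move=> eE.
under eq_bigr => u _ do under eq_bigr => v _ do rewrite -cardsX.
rewrite pair_big /= /num_edges -sum1_card (partition_big (fun xy => (g xy.1, g xy.2)) predT) //=.
apply: eq_bigr => -[u v] _ /=; rewrite sum1_card.
(* Between two fibres the graph is complete or empty, according to [E u v]. *)
case Euv: (E u v); rewrite ?muln1 ?muln0.
  apply: eq_card => -[x y]; rewrite [LHS]unfold_in !inE /=.
  have [xA|] := boolP (x \in A) => //=; have [yB|] := boolP (y \in B); rewrite ?andbF //=.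
  rewrite eE // xpair_eqE; case: eqP => [->|]; rewrite ?andbF //=; case: eqP => [->|]; rewrite ?andbF //.
  by rewrite Euv.
apply/eqP; rewrite -leqn0 leqNgt; apply/negP => /card_gt0P[[x y]].
rewrite unfold_in !inE /= xpair_eqE => /andP[/andP[/andP[xA yB]]].
by rewrite eE // => Exy /andP[/eqP xu /eqP yv]; move: Exy; rewrite xu yv Euv.
Qed.

Lemma sum_fibres (V U : finType) (g : V -> U) (A : {set V}) :
  (\sum_u #|[set x in A | g x == u]|)%N = #|A|.
Proof.
rewrite -[RHS]sum1_card (partition_big g predT) //=.
by apply: eq_bigr => u _; rewrite -sum1_card; apply: eq_bigl => x; rewrite inE.
Qed.

(** Both bounds come from injections: [j * N + r] maps ['I_m] into the class, and division by [N]
    maps the class into ['I_m.+1]. *)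
Lemma card_residue_class (n N r : nat) (m := (n %/ N)%N) : (r < N)%N ->
  (m <= #|[set x : 'I_n | x %% N == r]| <= m.+1)%N.
Proof.
move=> rN; have N0 : (0 < N)%N by apply: leq_trans rN.
apply/andP; split.
  have lt (j : 'I_m) : (j * N + r < n)%N.
    apply: leq_trans (leq_trunc_div n N).
    by apply: leq_trans (leq_mul (ltn_ord j) (leqnn N)); rewrite mulSn addnC ltn_add2r.
  pose h j := Ordinal (lt j).
  have hinj : injective h.
    move=> i j /(congr1 val) /= /eqP; rewrite eqn_add2r eqn_pmul2r // => /eqP ij.
    exact: val_inj.
  rewrite -{1}[m]card_ord -cardsT -(card_imset _ hinj); apply: subset_leq_card.
  by apply/subsetP => _ /imsetP[j _ ->]; rewrite inE /= modnMDl modn_small.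
have lt (x : 'I_n) : (x %/ N < m.+1)%N by rewrite ltnS leq_div2r // ltnW.
pose h x := Ordinal (lt x).
rewrite -[X in (_ <= X)%N]card_ord -(card_in_imset (f := h)) ?max_card //.
move=> x y; rewrite !inE => /eqP xr /eqP yr /(congr1 val) /= xy.
by apply: val_inj => /=; rewrite (divn_eq x N) (divn_eq y N) xy xr yr.
Qed.

Lemma balanced_map (T : finType) (n : nat) (m := (n %/ #|T|)%N) :
  (0 < #|T|)%N ->
  exists f : 'I_n -> T,
    forall t, (m <= #|[set x | f x == t]| <= m.+1)%N.
Proof.
move=> T0; exists (fun x => enum_val (Ordinal (ltn_pmod x T0))) => t.
have -> : [set x : 'I_n | enum_val (Ordinal (ltn_pmod x T0)) == t] =
    [set x : 'I_n | x %% #|T| == enum_rank t]%N.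
  apply/setP => x; rewrite !inE -[in LHS](enum_rankK t) (inj_eq enum_val_inj).
  by rewrite -val_eqE.
exact/card_residue_class/ltn_ord.
Qed.

(** Otherwise squaring would be onto, hence injective on the finite set [F], but 1 and -1 have the
    same square and differ when 2 is nonzero. *)
Lemma exists_nonsquare (F : finFieldType) : (2 : F) != 0 ->
  exists eps : F, forall t, t ^+ 2 != eps.
Proof.
move=> two; have [/existsP[eps /forallP]|/existsPn surj] :=
  boolP [exists eps : F, [forall t, t ^+ 2 != eps]]; first by exists eps.
have sq_onto : [set t ^+ 2 | t in F] = [set: F].
  apply/setP => eps; rewrite inE; have := surj eps.
  by rewrite negb_forall => /existsP[t /negPn/eqP <-]; apply: imset_f.
have /imset_injP sq_inj : #|[set t ^+ 2 | t in F]| == #|F|.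
  by rewrite sq_onto cardsT.
have /eqP : 1 = -1 :> F by apply: sq_inj; rewrite ?sqrrN.
by rewrite -subr_eq0 opprK -mulr2n (negPf two).
Qed.

(** All pairs of large subsets have density at least [3 / (4 q)], while the whole pair has density
    at most [3 / (2 q)]; regularity allows exactly this factor 2. Both bounds use
    [(m + 1)^2 <= 3/2 m^2], which holds from [m = 5] on. *)
Lemma blowup_half_regular (R : realType) (V U : finType) (e : rel V)
    (E : rel U) (g : V -> U) (A B : {set V}) (q m : nat) (delta : R) :
  (0 < q)%N -> #|U| = (q * q)%N ->
  (forall u, #|neighbours E u| = q) ->
  (forall u u', u != u' -> (#|neighbours E u :&: neighbours E u'| <= 1)%N) ->
  (5 <= m)%N ->
  (forall u, (m <= #|[set x in A | g x == u]| <= m.+1)%N) ->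
  (forall u, (m <= #|[set x in B | g x == u]| <= m.+1)%N) ->
  {in A & B, forall x y, e x y = E (g x) (g y)} ->
  0 < delta -> delta <= 1 -> 24 <= delta ^+ 2 * q%:R ->
  3 / 4 / q%:R <= density R e A B /\ half_regular delta e A B.
Proof.
move=> q_gt0 cardU deg codeg m5 fibA fibB eE d0 d1 qd.
have q0 : 0 < q%:R :> R by rewrite ltr0n.
have m0 : 5 <= m%:R :> R by rewrite ler_nat.
have card_lb (X : {set V}) : (forall u, (m <= #|[set x in X | g x == u]| <= m.+1)%N) ->
    q%:R ^+ 2 * m%:R <= #|X|%:R :> R.
  move=> fib; rewrite expr2 -!natrM ler_nat -cardU -(sum_fibres g) -sum_nat_const.
  by apply: leq_sum => u _; case/andP: (fib u).
have A_lb := card_lb _ fibA; have B_lb := card_lb _ fibB.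
have qm0 : 0 < q%:R ^+ 2 * m%:R :> R by rewrite mulr_gt0 ?exprn_gt0 //; lra.
have A0 := lt_le_trans qm0 A_lb; have B0 := lt_le_trans qm0 B_lb.
have sub_fib (X X' : {set V}) : X' \subset X ->
    (forall u, (m <= #|[set x in X | g x == u]| <= m.+1)%N) ->
    forall u, (0 : R) <= #|[set x in X' | g x == u]|%:R <= m.+1%:R.
  move=> sX fib u; rewrite ler0n ler_nat /=; case/andP: (fib u) => _; apply: leq_trans.
  by apply/subset_leq_card/subsetP => x; rewrite !inE => /andP[/(subsetP sX) -> ->].
have core (A' B' : {set V}) : A' \subset A -> B' \subset B ->
    delta * #|A|%:R <= #|A'|%:R -> delta * #|B|%:R <= #|B'|%:R ->
    3 / 4 / q%:R <= density R e A' B'.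
  move=> sA sB dA dB.
  have A'0 := lt_le_trans (mulr_gt0 d0 A0) dA.
  have B'0 := lt_le_trans (mulr_gt0 d0 B0) dB.
  rewrite /density ler_pdivlMr ?mulr_gt0 //.
  rewrite (@num_edges_fibres _ _ e E g); last first.
    by move=> x y xA yB; apply: eE; [apply: (subsetP sA)|apply: (subsetP sB)].
  rewrite -[in leLHS](sum_fibres g A') -[in leLHS](sum_fibres g B') !natr_sum.
  under [leRHS]eq_bigr => u _ do (rewrite natr_sum; under eq_bigr => v _ do rewrite !natrM).
  pose w (X : {set V}) u : R := #|[set x in X | g x == u]|%:R.
  apply: (weighted_edges_lb (w := w A') (w' := w B') (M := m.+1%:R)) => //.
  - exact: sub_fib sA fibA.
  - exact: sub_fib sB fibB.
  rewrite -!natr_sum !sum_fibres.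
  have dqm : 0 <= delta * (q%:R ^+ 2 * m%:R) by rewrite mulr_ge0 ?ltW.
  apply: le_trans (ler_pM dqm dqm (le_trans (ler_wpM2l (ltW d0) A_lb) dA)
                                  (le_trans (ler_wpM2l (ltW d0) B_lb) dB)).
  have -> : delta * (q%:R ^+ 2 * m%:R) * (delta * (q%:R ^+ 2 * m%:R)) =
      q%:R ^+ 3 * ((delta ^+ 2 * q%:R) * m%:R ^+ 2) by ring.
  rewrite [16 * _]mulrC -[leLHS]mulrA; apply: ler_wpM2l; first by rewrite exprn_ge0.
  (* The 24 is the 16 of [weighted_edges_lb] times the bound 3/2 on [((m + 1) / m)^2]. *)
  apply: le_trans (_ : 24 * m%:R ^+ 2 <= _); first by rewrite -natr1; nra.
  by apply: ler_wpM2r; first exact: sqr_ge0.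
have triv (X : {set V}) : delta * #|X|%:R <= #|X|%:R :> R by rewrite ler_piMl.
split; first exact: core.
move=> A' B' sA sB dA dB; apply: le_trans (core A' B' sA sB dA dB).
have : density R e A B <= 3 / 2 / q%:R; last by lra.
rewrite /density ler_pdivrMr ?mulr_gt0 //.
apply: (@le_trans _ _ (q%:R ^+ 3 * m.+1%:R ^+ 2)).
  rewrite (num_edges_fibres eE) -!natrX -natrM ler_nat.
  (* [E] relates [q^2 * q] pairs, and each is blown up to at most [(m + 1)^2] edges. *)
  have -> : (q ^ 3 * m.+1 ^ 2 = \sum_(u in U) \sum_v m.+1 * m.+1 * E u v)%N.
    under eq_bigr => u _.
      rewrite -big_distrr /= -big_mkcond sum1_card -[X in (_ * X)%N](_ : q = _).
        over.
      by rewrite -(deg u) cardsE.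
    by rewrite sum_nat_const cardU; ring.
  apply: leq_sum => u _; apply: leq_sum => v _; rewrite leq_mul2r leq_mul ?orbT //.
    by case/andP: (fibA u).
  by case/andP: (fibB v).
have AB_lb : q%:R ^+ 2 * m%:R * (q%:R ^+ 2 * m%:R) <= #|A|%:R * #|B|%:R :> R.
  by apply: ler_pM => //; apply: ltW.
have c0 : 0 <= 3 / 2 / q%:R :> R by apply: divr_ge0; [lra|exact: ltW].
apply: le_trans (ler_wpM2l c0 AB_lb).
have -> : 3 / 2 / q%:R * (q%:R ^+ 2 * m%:R * (q%:R ^+ 2 * m%:R)) =
    q%:R ^+ 3 * (3 / 2 * m%:R ^+ 2) :> R by field; rewrite gt_eqF.
apply: ler_wpM2l; first by rewrite exprn_ge0.
by rewrite -natr1; nra.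
Qed.

(** * Parabola graphs and the triangle-free pattern on three copies of [F * F] *)

Definition parabola_rel (F : finFieldType) (c eps : F) : rel (F * F) :=
  fun x y => y.2 - x.2 == c * (y.1 - x.1) ^+ 2 + eps.

Lemma parabola_degree (F : finFieldType) (c eps : F) (x : F * F) :
  #|neighbours (parabola_rel c eps) x| = #|F|.
Proof.
pose h t : F * F := (t, x.2 + (c * (t - x.1) ^+ 2 + eps)).
have h_inj : injective h by move=> s t [].
rewrite -(card_image h_inj predT); apply: eq_card => -[y1 y2].
rewrite !inE /parabola_rel /=; apply/eqP/imageP => [yx|[t _ [-> ->]]].
  by exists y1; rewrite // /h -yx addrC subrK.
by rewrite addrC addKr.
Qed.

(** The neighbourhoods are translates of one parabola. Subtracting two of their equations cancels
    the squares and leaves a linear equation in [y1] with slope [2 c (x1 - x1')]. This determines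
    [y1], unless [x1 = x1'], when a common neighbour would force [x2 = x2']. *)
Lemma parabola_codegree (F : finFieldType) (c eps : F) (x x' : F * F) :
  2 * c != 0 -> x != x' ->
  (#|neighbours (parabola_rel c eps) x :&:
     neighbours (parabola_rel c eps) x'| <= 1)%N.
Proof.
case: x x' => [x1 x2] [x1' x2'] c0 neq; apply/card_le1_eqP => -[y1 y2] [z1 z2].
rewrite !inE /parabola_rel /=.
move=> /andP[/eqP yx /eqP yx'] /andP[/eqP zx /eqP zx'].
have : 2 * c * (x1 - x1') * (y1 - z1) = 0.
  have -> : 2 * c * (x1 - x1') * (y1 - z1) =
    (c * (y1 - x1') ^+ 2 + eps) - (c * (y1 - x1) ^+ 2 + eps)
    - ((c * (z1 - x1') ^+ 2 + eps) - (c * (z1 - x1) ^+ 2 + eps)) by ring.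
  by rewrite -yx -yx' -zx -zx'; ring.
move/eqP; rewrite !mulf_eq0 -mulf_eq0 (negPf c0) /= !subr_eq0 => /orP[]/eqP.
  move=> eq1; case/negP: neq; rewrite eq1 xpair_eqE eqxx /=.
  by move: yx; rewrite eq1 -yx' => /addrI/oppr_inj ->.
by move=> eq1; move: yx; rewrite eq1 -zx => /addIr ->.
Qed.

Lemma parabola_triangle_free (F : finFieldType) (eps : F) (x y z : F * F) :
  (forall t, t ^+ 2 != eps) ->
  parabola_rel 2 0 x y -> parabola_rel 2 0 y z -> ~~ parabola_rel 1 eps x z.
Proof.
move=> nonsq /eqP xy /eqP yz; apply/eqP => xz.
(* The square root of [eps] is the difference of the two horizontal steps. *)
case/negP: (nonsq (y.1 - x.1 - (z.1 - y.1))); apply/eqP.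
have sum_sq : 2 * (y.1 - x.1) ^+ 2 + 2 * (z.1 - y.1) ^+ 2 = 1 * (z.1 - x.1) ^+ 2 + eps.
  by rewrite -xz -[X in X + _]addr0 -[X in _ + X]addr0 -xy -yz; ring.
have -> : eps = 2 * (y.1 - x.1) ^+ 2 + 2 * (z.1 - y.1) ^+ 2 - 1 * (z.1 - x.1) ^+ 2.
  by rewrite sum_sq; ring.
by ring.
Qed.

(** Edges are oriented from lower to higher copies and symmetrised only in the final graph, so a
    triangle is treated by its orientation. *)
Definition class_rel (F : finFieldType) (eps : F) : rel ('I_3 * (F * F)) :=
  fun s t =>
    match val s.1, val t.1 with
    | 0, 1 | 1, 2 => (parabola_rel 2 0 s.2 t.2)%R
    | 0, 2 => (parabola_rel 1 eps s.2 t.2)%R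
    | _, _ => false
    end%N.

Lemma class_rel_lt (F : finFieldType) (eps : F) (s t : 'I_3 * (F * F)) :
  class_rel eps s t -> (s.1 < t.1)%N.
Proof.
by rewrite /class_rel; case: s t => [[[|[|[|?]]] ?] ?] [[[|[|[|?]]] ?] ?].
Qed.

Lemma class_rel_triangle_free (F : finFieldType) (eps : F)
    (s t u : 'I_3 * (F * F)) :
  (forall a, a ^+ 2 != eps) ->
  class_rel eps s t -> class_rel eps t u -> ~~ class_rel eps s u.
Proof.
move=> nonsq; rewrite /class_rel.
case: s t u => [[[|[|[|?]]] ?] x] [[[|[|[|?]]] ?] y] [[[|[|[|?]]] ?] z] //=.
exact: parabola_triangle_free.
Qed.

(** * Choice of the field size and assembly *)

Lemma exists_pow3 (R : realType) (delta : R) : 0 < delta -> delta <= 1 ->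
  exists2 k, (0 < k)%N &
    24 <= delta ^+ 2 * (3 ^ k)%:R /\ delta ^+ 2 * (3 ^ k)%:R <= 72.
Proof.
move=> d0 d1; have d2 : 0 < delta ^+ 2 by rewrite exprn_gt0.
have d21 : delta ^+ 2 <= 1 by rewrite exprn_ile1 ?(ltW d0).
have ex : exists k, 24 <= delta ^+ 2 * (3 ^ k)%:R.
  exists (Num.bound (24 / delta ^+ 2)); rewrite mulrC -ler_pdivrMr //.
  have h0 : 0 <= 24 / delta ^+ 2 by rewrite divr_ge0 ?ltW.
  apply: le_trans (ltW (archi_boundP h0)) _.
  by rewrite ler_nat ltnW // ltn_expl.
(* The exponent 0 fails since [delta ^+ 2 <= 1]. By minimality the previous power gives less than
   24, and tripling gives at most 72. *)
case: (ex_minnP ex) => -[|k] lb minK; first by move: lb; rewrite expn0 mulr1; lra.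
exists k.+1 => //; split => //.
have : ~~ (24 <= delta ^+ 2 * (3 ^ k)%:R) by apply/negP => /minK; rewrite ltnn.
by rewrite -ltNge expnS natrM; lra.
Qed.

Theorem proposition6p1 (R : realType) (delta : R)
    (delta_gt0 : 0 < delta) (delta_le1 : delta <= 1)
    (p : R) (p_gt0 : 0 < p) (p_le : p <= 10 ^- 3 * delta ^+ 5) :
  exists n0 : nat, forall n : nat, (n0 <= n)%N ->
    exists (e : rel 'I_n) (A B C : {set 'I_n}),
      [/\ simple_graph e,
          tripartition e A B C,
          [/\ p <= density R e A B, p <= density R e B C
            & p <= density R e A C],
          [/\ half_regular delta e A B, half_regular delta e B C
            & half_regular delta e A C]
        & triangle_free e].
Proof.
(* The lower bound on [q] serves regularity and the upper bound serves density; characteristic 3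
   makes 2 invertible. *)
have [k k0 [q_lb q_ub]] := exists_pow3 delta_gt0 delta_le1.
have [F pcharF cardF] := pPrimePowerField (isT : prime 3) k0.
have two0 : (2 : F) != 0.
  by rewrite -(dvdn_pcharf pcharF).
have [eps nonsq] := exists_nonsquare two0.
pose q := #|F|; pose T : finType := ('I_3 * (F * F))%type.
have q_gt0 : (0 < q)%N by rewrite /q cardF expn_gt0.
have T_gt0 : (0 < #|T|)%N by rewrite !card_prod card_ord !muln_gt0 q_gt0.
(* From here on every fibre has at least 5 vertices. *)
exists (5 * #|T|)%N => n n_ge.
have [f fib] := balanced_map n T_gt0.
have m5 : (5 <= n %/ #|T|)%N by rewrite leq_divRL.
pose cl i := [set x | (f x).1 == i].
pose e x y := class_rel eps (f x) (f y) || class_rel eps (f y) (f x).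
have e_cl (i j : 'I_3) : (i < j)%N -> {in cl i & cl j, forall x y,
    e x y = class_rel eps (i, (f x).2) (j, (f y).2)}.
  move=> ij x y; rewrite !inE => /eqP xi /eqP yj; rewrite /e orbC.
  case: (boolP (class_rel _ (f y) _)) => [/class_rel_lt|_ /=].
    by rewrite xi yj ltnNge ltnW.
  by rewrite -xi -yj -!surjective_pairing.
have fib_cl i u :
    (n %/ #|T| <= #|[set x in cl i | (f x).2 == u]| <= (n %/ #|T|).+1)%N.
  suff -> : [set x in cl i | (f x).2 == u] = [set x | f x == (i, u)] by [].
  by apply/setP => x; rewrite !inE [f x]surjective_pairing xpair_eqE.
(* Since [delta ^+ 2 * q <= 72], [p * q] is at most 72/1000, well below 3/4. *)
have q_le : p <= 3 / 4 / q%:R.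
  have q0 : 0 < q%:R :> R by rewrite ltr0n.
  rewrite ler_pdivlMr //; apply: le_trans (ler_wpM2r (ltW q0) p_le) _.
  have -> : 10 ^- 3 * delta ^+ 5 * q%:R = 10 ^- 3 * (delta ^+ 3 * (delta ^+ 2 * q%:R)).
    by ring.
  have : delta ^+ 3 * (delta ^+ 2 * q%:R) <= 1 * 72.
    apply: ler_pM => //; rewrite ?mulr_ge0 ?exprn_ge0 ?(ltW delta_gt0) //.
      by rewrite exprn_ile1 ?(ltW delta_gt0).
    by rewrite /q cardF.
  by lra.
have cardFF : #|{: F * F}| = (q * q)%N by rewrite card_prod.
have qd : 24 <= delta ^+ 2 * q%:R by rewrite /q cardF.
(* Stated for general [c] and [a], so as to cover both kinds of parabola. *)
have pair_ok (i j : 'I_3) c a : (i < j)%N -> 2 * c != 0 ->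
    (forall s t, class_rel eps (i, s) (j, t) = parabola_rel c a s t) ->
    p <= density R e (cl i) (cl j) /\ half_regular delta e (cl i) (cl j).
  move=> ij c0 relE.
  have [] := @blowup_half_regular R _ _ e (parabola_rel c a) (fun x => (f x).2)
    (cl i) (cl j) q _ delta q_gt0 cardFF (parabola_degree c a)
    (fun u u' => @parabola_codegree _ c a u u' c0) m5 (fib_cl i) (fib_cl j) _
    delta_gt0 delta_le1 qd.
    by move=> x y xi yj; rewrite (e_cl i j) // relE.
  by move=> dens reg; split=> //; apply: le_trans dens.
pose o1 : 'I_3 := Ordinal (isT : (1 < 3)%N).
pose o2 : 'I_3 := Ordinal (isT : (2 < 3)%N).
have four0 : (2 * 2 : F) != 0 by rewrite mulf_neq0.
have two1 : (2 * 1 : F) != 0 by rewrite mulr1.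
have [d01 r01] := pair_ok ord0 o1 2 0 isT four0 (fun _ _ => erefl).
have [d12 r12] := pair_ok o1 o2 2 0 isT four0 (fun _ _ => erefl).
have [d02 r02] := pair_ok ord0 o2 1 eps isT two1 (fun _ _ => erefl).
have ord3 (i : 'I_3) : [|| i == ord0, i == o1 | i == o2].
  by case: i => [[|[|[|i]]] ?].
have cl_disj i j : i != j -> [disjoint cl i & cl j].
  move=> ij; rewrite -setI_eq0; apply/eqP/setP => x; rewrite !inE.
  by case: eqP => //= ->; apply: negbTE.
have e_lt x y : e x y -> ((f x).1 < (f y).1)%N || ((f y).1 < (f x).1)%N.
  by case/orP => /class_rel_lt ->; rewrite ?orbT.
have cl_ind i : independent e (cl i).
  move=> x y; rewrite !inE => /eqP xi /eqP yi.
  by apply/negP => /e_lt; rewrite xi yi ltnn.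
exists e, (cl ord0), (cl o1), (cl o2); split=> //.
- split=> [x y|x]; first by rewrite /e orbC.
  by apply/negP => /e_lt; rewrite ltnn.
- split; [|by split; apply: cl_disj|by split].
  by apply/setP => x; rewrite !inE -orbA ord3.
have tf s t u := @class_rel_triangle_free F eps s t u nonsq.
(* Of the eight orientations of a triangle, the two cyclic ones contradict the order of the copies;
   the other six are transitive and fall to [tf]. *)
move=> x y z [/orP[] xy /orP[] yz /orP[] xz].
- by case/negP: (tf _ _ _ xy yz).
- have := ltn_trans (class_rel_lt xy) (ltn_trans (class_rel_lt yz) (class_rel_lt xz)).
  by rewrite ltnn.
- by case/negP: (tf _ _ _ xz yz).
- by case/negP: (tf _ _ _ xz xy).
- by case/negP: (tf _ _ _ xy xz).
- by case/negP: (tf _ _ _ yz xz).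
- have := ltn_trans (class_rel_lt xy) (ltn_trans (class_rel_lt xz) (class_rel_lt yz)).
  by rewrite ltnn.
- by case/negP: (tf _ _ _ yz xy).
Qed.
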